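(* Let $\mathcal{G}$ be a directed (possibly weighted) graph of size $n$, with vertex set $\{1,\ldots,n\}$ and (weighted) adjacency matrix $A$. Let $p(x,y;\mathcal{G})$, $p(x;X)$, $p(y;Y)$, $F(\cdot;X)$, $F(\cdot;Y)$, $Q(\cdot;X)$, $Q(\cdot;Y)$, the LP graph basis functions $S_j(\cdot;X)$, $S_k(\cdot;Y)$ and the LP graph transform coefficients $\mathrm{LP}[j,k;\mathcal{G}]$ be as defined in the context, and let $\mathscr{C}:[0,1]^2\to[0,\infty)$ be the function $$\mathscr{C}(u,v;\mathcal{G})=\frac{p\big(Q(u;X),Q(v;Y);\mathcal{G}\big)}{p\big(Q(u;X);X\big)\,p\big(Q(v;Y);Y\big)},$$ where $u=F(x;X)$, $v=F(y;Y)$ for $x,y\in\{1,\ldots,n\}$. Then $\mathscr{C}$ is a proper density function on the unit square (nonnegative with total integral one), and it admits the following orthogonal decomposition in terms of the piecewise-constant product LP basis over the unit square: for $u=F(x;X)$, $v=F(y;Y)$ and $x,y\in\{1,\ldots,n\}$, $$\mathscr{C}(u,v;\mathcal{G})-1=\sum_{j=1}^{n-1}\sum_{k=1}^{n-1}\mathrm{LP}[j,k;\mathcal{G}]\,S_j(u;X)\,S_k(v;Y).$$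
   Context: Let $A=(A(x,y))_{x,y=1}^n$ be the (weighted) adjacency matrix of $\mathcal{G}$ and $N=\sum_{x,y=1}^n A(x,y)$. Define $$p(x,y;\mathcal{G})=A(x,y)/N,\qquad p(x;X)=\sum_{y=1}^n A(x,y)/N,\qquad p(y;Y)=\sum_{x=1}^n A(x,y)/N.$$ These are regarded as the joint probability mass function and the marginal probability mass functions of a pair of discrete random variables $(X,Y)$ with values in $\{1,\ldots,n\}$. For $Z\in\{X,Y\}$: $F(z;Z)=\Pr[Z\le z]$ is the distribution function; $Q(u;Z)=\inf\{z: F(z;Z)\ge u\}$ is the quantile function; and $F^{\mathrm{mid}}(z;Z)=F(z;Z)-\tfrac12 p(z;Z)$ is the mid-distribution function. Put $$T_1(z;Z)=\frac{\sqrt{12}\,\big[F^{\mathrm{mid}}(z;Z)-\tfrac12\big]}{\sqrt{1-\sum_{z'} p(z';Z)^3}} .$$ The functions $T_1(\cdot;Z),T_2(\cdot;Z),\ldots,T_{n-1}(\cdot;Z)$ are constructed by Gram–Schmidt orthonormalization of the powers of $T_1(\cdot;Z)$, so that they satisfy $\sum_z T_j(z;Z)p(z;Z)=0$, $\sum_z T_j(z;Z)^2p(z;Z)=1$, and $\sum_z T_j(z;Z)T_k(z;Z)p(z;Z)=0$ for $j\ne k$. The LP graph basis functions on the unit interval are $S_j(u;Z)=T_j(Q(u;Z);Z)$, $j=1,\ldots,n-1$. The LP graph transform is, for $j,k=1,\ldots,n-1$, $$\mathrm{LP}[j,k;\mathcal{G}]=\sum_{x=1}^n\sum_{y=1}^n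 p(x,y;\mathcal{G})\,T_j(x;X)\,T_k(y;Y).$$ *)

(* Defs.v *)
From HB Require Import structures.
From mathcomp Require Import all_boot all_order all_algebra.
From mathcomp Require Import all_classical all_reals all_analysis.
Import Order.TTheory GRing.Theory Num.Theory.
Import numFieldNormedType.Exports.

Set Implicit Arguments.
Unset Strict Implicit.
Unset Printing Implicit Defensive.

Local Open Scope classical_set_scope.
Local Open Scope ring_scope.

(* A weighted directed graph on n.+1 vertices is its adjacency matrix
   A : 'M[R]_n.+1; the vertices 1, ..., n.+1 are the elements of 'I_n.+1, in
   the same order. *)

Section LPBasis.
Variables (R : realType) (n : nat).

(* Here p is the probability mass function of one variable Z. *)
Implicit Types (p f g : 'I_n.+1 -> R) (z : 'I_n.+1) (u : R).

Definition dist_fun p z : R := \sum_(z' < n.+1 | (z' <= z)%N) p z'.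

(* The infimum is attained for u <= 1, since dist_fun p ord_max = 1 for a
   probability mass function; for u > 1 the value is ord_max. *)
Definition quantile p u : 'I_n.+1 :=
  [arg min_(z < ord_max | (u <= dist_fun p z)%R) (z : nat)]%N.

Definition mid_dist_fun p z : R := dist_fun p z - p z / 2.

Definition lp_T1 p z : R :=
  Num.sqrt 12 * (mid_dist_fun p z - 2^-1)
    / Num.sqrt (1 - \sum_(z' < n.+1) p z' ^+ 3).

Definition dotp p f g : R := \sum_(z < n.+1) f z * g z * p z.

(* As x / 0 = 0, a vector that is p-almost surely in the span of the previous
   ones yields the zero function, the usual convention for Gram-Schmidt on a
   dependent family. *)
Definition gs_step p (s : seq ('I_n.+1 -> R)) f : 'I_n.+1 -> R :=
  let r := fun z => f z - \sum_(t <- s) dotp p f t * t z in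
  fun z => r z / Num.sqrt (dotp p r r).

Fixpoint gram_schmidt p (e : nat -> 'I_n.+1 -> R) (j : nat) :
    seq ('I_n.+1 -> R) :=
  if j is i.+1 then
    let s := gram_schmidt p e i in rcons s (gs_step p s (e i))
  else [::].

Definition lp_power p (j : nat) : 'I_n.+1 -> R := fun z => lp_T1 p z ^+ j.

(* The family starts with the power 0, so that lp_T p 0 is the constant 1 and
   the later functions are centered; lp_T1 p is already centered and
   normalized, so that lp_T p 1 is lp_T1 p up to p-null points. *)
Definition lp_T p (j : nat) : 'I_n.+1 -> R :=
  gs_step p (gram_schmidt p (lp_power p) j) (lp_power p j).

Definition lp_S p (j : nat) u : R := lp_T p j (quantile p u).

End LPBasis.

Section Graph.
Variables (R : realType) (n : nat) (A : 'M[R]_n.+1).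

Definition total_weight : R := \sum_(x < n.+1) \sum_(y < n.+1) A x y.

Definition joint_pmf (x y : 'I_n.+1) : R := A x y / total_weight.

Definition pmfX (x : 'I_n.+1) : R := (\sum_(y < n.+1) A x y) / total_weight.

Definition pmfY (y : 'I_n.+1) : R := (\sum_(x < n.+1) A x y) / total_weight.

Definition lp_coef (j k : nat) : R :=
  \sum_(x < n.+1) \sum_(y < n.+1)
    joint_pmf x y * lp_T pmfX j x * lp_T pmfY k y.

Definition graph_density (u v : R) : R :=
  joint_pmf (quantile pmfX u) (quantile pmfY v)
    / (pmfX (quantile pmfX u) * pmfY (quantile pmfY v)).

End Graph.

Section UnitSquare.
Variable R : realType.

Definition unit_square : set (R * R) := `[0, 1] `*` `[0, 1].

Definition square_integral (f : R -> R -> R) : \bar R :=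
  (\int[(@lebesgue_measure R \x @lebesgue_measure R)%E]_(w in unit_square)
     (f w.1 w.2)%:E)%E.

Definition square_density (f : R -> R -> R) : Prop :=
  [/\ measurable_fun unit_square (fun w : R * R => f w.1 w.2),
      forall u v, 0 <= u <= 1 -> 0 <= v <= 1 -> 0 <= f u v
    & square_integral f = 1%E].

End UnitSquare.

(* Main.v *)
(** On [0,1] the quantile function pushes Lebesgue measure to the probability
    mass function p, so an integral over the square of a function of
    (Q(u;X), Q(v;Y)) is a finite double sum weighted by p(x;X) p(y;Y).
    The score T_1 separates each point of the support of p from every other
    vertex, so by Lagrange interpolation the powers 0, ..., n-1 of T_1 span
    p-a.e. all functions, and the Gram-Schmidt family, null vectors included,
    is complete: sum_j T_j(z) T_j(z') = [z = z'] / p(z') on the support.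
    Summing p(x,y) against the product of the kernels at x0 and y0 gives
    p(x0,y0) / (p(x0) p(y0)); the terms with j = 0 or k = 0 contribute only
    LP[0,0] = 1, the others being means of centered functions. *)
Require Import Defs.
From HB Require Import structures.
From mathcomp Require Import all_boot all_order all_algebra.
From mathcomp Require Import all_classical all_reals all_analysis.
From mathcomp Require Import ring lra.
Import Order.TTheory GRing.Theory Num.Theory.
Import numFieldNormedType.Exports.

Local Open Scope classical_set_scope.
Local Open Scope ring_scope.

Set Implicit Arguments.
Unset Strict Implicit.
Unset Printing Implicit Defensive.

(** * Quantile function: its fibres on the unit interval and their lengths *)

Section Pmf.
Variables (R : realType) (n : nat) (p : 'I_n.+1 -> R).
Hypothesis p_ge0 : forall z, 0 <= p z.
Hypothesis p_sum1 : \sum_z p z = 1.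

Lemma dist_fun_max : dist_fun p ord_max = 1.
Proof.
by rewrite -p_sum1; apply: eq_bigl => z; rewrite -ltnS ltn_ord.
Qed.

Lemma dist_fun_le_sub (z w : 'I_n.+1) :
  (z < w)%N -> dist_fun p z <= dist_fun p w - p w.
Proof.
move=> zw; rewrite /dist_fun [in leRHS](bigD1 w)//= addrAC subrr add0r.
rewrite [leLHS]big_mkcond [leRHS]big_mkcond; apply: ler_sum => i _.
case: ifPn => iz; last by case: ifP.
by rewrite (ltnW (leq_ltn_trans iz zw)) -val_eqE/= ltn_eqF// (leq_ltn_trans iz).
Qed.

Lemma dist_fun_sub (w : 'I_n.+1) : (0 < w)%N ->
  exists2 z : 'I_n.+1, (z < w)%N & dist_fun p w - p w = dist_fun p z.
Proof.
move=> w0; have lt_pw : (w.-1 < n.+1)%N by rewrite (leq_ltn_trans (leq_pred _)).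
exists (Ordinal lt_pw); first by rewrite /= ltn_predL.
rewrite /dist_fun (bigD1 w)//= addrAC subrr add0r; apply: eq_bigl => z.
by rewrite -val_eqE andbC -ltn_neqAle -[in RHS]ltnS prednK.
Qed.

Lemma quantileP u : u <= 1 ->
  u <= dist_fun p (quantile p u) /\
  forall z, u <= dist_fun p z -> (quantile p u <= z)%N.
Proof.
by move=> u1; rewrite /quantile; case: arg_minnP; rewrite ?dist_fun_max.
Qed.

(** Half-open on the left, except at vertex 0, where the left end is closed so that the level
    [u = 0], whose quantile is vertex 0, is covered. The left endpoint is the mass strictly below
    [z]. *)
Definition quantile_cell (z : 'I_n.+1) : interval R :=
  Interval (BSide (z == 0%N :> nat) (dist_fun p z - p z))
           (BRight (dist_fun p z)).

Lemma dist_fun_ord0 (z : 'I_n.+1) : z = 0%N :> nat -> dist_fun p z = p z.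
Proof.
move=> z0; rewrite /dist_fun (bigD1 z)//= big1 ?addr0// => i.
by rewrite z0 leqn0 -val_eqE/= z0 => /andP[/eqP ->].
Qed.

Lemma quantile_cellP z u : 0 <= u <= 1 ->
  (u \in quantile_cell z) = (quantile p u == z).
Proof.
move=> /andP[u0 u1]; have [Qu minQ] := quantileP u1.
rewrite itv_boundlr /=; apply/andP/eqP => [[lo hi]|<-{z}].
  (* A quantile strictly below [z] would put [u] at or below the left endpoint, which is excluded
     since [z] is then not vertex 0. *)
  rewrite bnd_simp in hi; apply/val_inj/eqP; rewrite eqn_leq minQ//= leqNgt.
  apply/negP => Qz; have z0 := leq_ltn_trans (leq0n _) Qz.
  move: lo; rewrite gtn_eqF// bnd_simp ltNge => /negP; apply.
  by rewrite (le_trans Qu)// dist_fun_le_sub.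
split; last by rewrite bnd_simp.
case: eqP => [Q0|/eqP Q0].
  by rewrite bnd_simp dist_fun_ord0// subrr.
(* Otherwise the predecessor of the quantile would already reach level [u], against minimality. *)
rewrite bnd_simp ltNge; apply/negP => uF.
move: Q0; rewrite -lt0n => /dist_fun_sub[z zQ Fz].
by have := minQ z; rewrite -Fz leqNgt zQ => /(_ uF).
Qed.

Lemma lebesgue_quantile_cell z :
  lebesgue_measure [set` quantile_cell z] = (p z)%:E.
Proof.
rewrite lebesgue_measure_itv /= lte_fin ltrBlDr ltrDl -EFinB opprB addrC subrK.
by case: ltP => // pz; congr EFin; apply/eqP; rewrite eq_le p_ge0 pz.
Qed.

Lemma quantile_cell_sub01 z : [set` quantile_cell z] `<=` `[0, 1].
Proof.
move=> u; rewrite /= itv_boundlr !bnd_simp => /andP[lo hi].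
have le_p0F : 0 <= dist_fun p z - p z.
  rewrite /dist_fun (bigD1 z)//= addrAC subrr add0r; exact: sumr_ge0.
have F1 : dist_fun p z <= 1.
  rewrite -p_sum1 /dist_fun big_mkcond; apply: ler_sum => i _.
  by case: ifP.
rewrite in_itv /= (le_trans hi F1) andbT (le_trans le_p0F)//.
by case: eqP lo => _; rewrite bnd_simp// => /ltW.
Qed.
End Pmf.

(** * Gram-Schmidt for a possibly degenerate weighted inner product *)

Section GramSchmidt.
Variables (R : realType) (n : nat) (p : 'I_n.+1 -> R).
Hypothesis p_ge0 : forall z, 0 <= p z.
Implicit Types (f g h : 'I_n.+1 -> R).

Lemma dotpC f g : dotp p f g = dotp p g f.
Proof. by apply: eq_bigr => z _; rewrite (mulrC (f z)). Qed.

Lemma dotp_congl f g h :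
  (forall z, p z != 0 -> f z = g z) -> dotp p f h = dotp p g h.
Proof.
move=> fg; apply: eq_bigr => z _.
by have [->|/fg->//] := eqVneq (p z) 0; rewrite !mulr0.
Qed.

Lemma dotpBl f g h :
  dotp p (fun z => f z - g z) h = dotp p f h - dotp p g h.
Proof. by rewrite -sumrB; apply: eq_bigr => z _; rewrite !mulrBl. Qed.

Lemma dotpZl a f h : dotp p (fun z => a * f z) h = a * dotp p f h.
Proof. by rewrite mulr_sumr; apply: eq_bigr => z _; rewrite !mulrA. Qed.

Lemma dotp_suml (I : Type) (s : seq I) (c : I -> R) (F : I -> 'I_n.+1 -> R) h :
  dotp p (fun z => \sum_(i <- s) c i * F i z) h =
  \sum_(i <- s) c i * dotp p (F i) h.
Proof.
rewrite /dotp.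
under [RHS]eq_bigr do rewrite mulr_sumr.
rewrite exchange_big; apply: eq_bigr => z _.
by rewrite !mulr_suml; apply: eq_bigr => i _; rewrite !mulrA.
Qed.

Lemma dotp_ge0 f : 0 <= dotp p f f.
Proof. by apply: sumr_ge0 => z _; rewrite mulr_ge0// -expr2 sqr_ge0. Qed.

Lemma dotp_eq0 f : dotp p f f = 0 -> forall z, p z != 0 -> f z = 0.
Proof.
move=> /eqP; rewrite psumr_eq0; last first.
  by move=> z _; rewrite mulr_ge0// -expr2 sqr_ge0.
move=> /allP f0 z pz; have := f0 z (mem_index_enum z).
by rewrite -expr2 mulf_eq0 (negbTE pz) orbF sqrf_eq0 => /eqP.
Qed.

Variable e : nat -> 'I_n.+1 -> R.

Definition gs_vec (j : nat) : 'I_n.+1 -> R :=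
  gs_step p (gram_schmidt p e j) (e j).

Definition gs_residual (j : nat) : 'I_n.+1 -> R :=
  fun z => e j z - \sum_(0 <= i < j) dotp p (e j) (gs_vec i) * gs_vec i z.

Lemma gram_schmidtE j : gram_schmidt p e j = [seq gs_vec i | i <- iota 0 j].
Proof.
have iotaS k : iota 0 k.+1 = rcons (iota 0 k) k.
  by rewrite -addn1 iotaD cats1.
by elim: j => [//|j IH]; rewrite iotaS map_rcons -IH.
Qed.

Lemma gs_vecE j : gs_vec j =
  fun z =>
    (Num.sqrt (dotp p (gs_residual j) (gs_residual j)))^-1 * gs_residual j z.
Proof.
have rE : gs_residual j =
    fun z => e j z - \sum_(t <- gram_schmidt p e j) dotp p (e j) t * t z.
  by apply/funext => z; rewrite gram_schmidtE big_map /gs_residual /index_iota subn0.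
by under [RHS]eq_fun do rewrite mulrC; rewrite rE.
Qed.

(** A residual of norm zero is multiplied by [0^-1 = 0], so the vector vanishes at every point and
    not only on the support of [p]. *)
Lemma gs_vec_norm_or_eq0 j :
  dotp p (gs_vec j) (gs_vec j) = 1 \/ (forall z, gs_vec j z = 0).
Proof.
rewrite gs_vecE; set r := gs_residual j.
have [r0|rN0] := eqVneq (dotp p r r) 0.
  by right=> z; rewrite r0 sqrtr0 invr0 mul0r.
left; rewrite dotpZl [X in _ * X]dotpC dotpZl mulrA -invfM -expr2 sqr_sqrtr ?dotp_ge0//.
by rewrite mulVf.
Qed.

(** Treats unit and null vectors uniformly: subtracting the projection on [gs_vec j] removes that
    component in both cases. *)
Lemma gs_vec_sqnormZ j g :
  dotp p (gs_vec j) (gs_vec j) * dotp p g (gs_vec j) = dotp p g (gs_vec j).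
Proof.
have [->|T0] := gs_vec_norm_or_eq0 j; first by rewrite mul1r.
suff -> : dotp p g (gs_vec j) = 0 by rewrite mulr0.
by apply: big1 => z _; rewrite T0 mulr0 mul0r.
Qed.

Lemma gs_vec_orth_lt i j :
  (i < j)%N -> dotp p (gs_vec j) (gs_vec i) = 0.
Proof.
elim/ltn_ind: j i => j IH i ij; rewrite (gs_vecE j); set c := (Num.sqrt _)^-1.
rewrite dotpZl dotpBl dotp_suml (bigD1_seq i) ?iota_uniq//=; last first.
  by rewrite mem_index_iota.
(* For [k] different from [i], both below [j], the induction hypothesis at the larger of the two
   indices kills the term. *)
rewrite mulrC big_seq_cond big1 ?addr0; last first.
  move=> k /andP[]; rewrite mem_index_iota => /= kj ki.
  have [lt_ki|lt_ik|/esym/eqP] := ltngtP k i; last by rewrite eq_sym (negbTE ki).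
    by rewrite [X in _ * X]dotpC (IH _ ij)// mulr0.
  by rewrite (IH _ kj)// mulr0.
by rewrite [X in _ - X]mulrC gs_vec_sqnormZ subrr mul0r.
Qed.

Lemma gs_vec_orth i j : i != j -> dotp p (gs_vec i) (gs_vec j) = 0.
Proof.
by case: ltngtP => // ij _; [rewrite dotpC|]; exact: gs_vec_orth_lt.
Qed.

(** Membership, up to [p]-null points, in the span of the first [m] vectors, expressed by the
    Fourier expansion. *)
Definition gs_reproduces (m : nat) f : Prop := forall z, p z != 0 ->
  f z = \sum_(0 <= i < m) dotp p f (gs_vec i) * gs_vec i z.

Lemma gs_reproduces_sum (I : eqType) (s : seq I) (c : I -> R)
    (F : I -> 'I_n.+1 -> R) m :
  (forall i, i \in s -> gs_reproduces m (F i)) ->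
  gs_reproduces m (fun z => \sum_(i <- s) c i * F i z).
Proof.
move=> rF z pz.
transitivity (\sum_(i <- s) \sum_(0 <= k < m)
    c i * (dotp p (F i) (gs_vec k) * gs_vec k z)).
  by apply: eq_big_seq => i /rF/(_ z pz) {1}->; rewrite mulr_sumr.
rewrite exchange_big; apply: eq_bigr => k _.
by rewrite dotp_suml mulr_suml; apply: eq_bigr => i _; rewrite mulrA.
Qed.

Lemma gs_reproduces_vec m j : (j < m)%N -> gs_reproduces m (gs_vec j).
Proof.
move=> jm z pz; rewrite (bigD1_seq j) ?iota_uniq ?mem_index_iota//=.
rewrite big1 ?addr0 => [|i ij]; last by rewrite gs_vec_orth ?mul0r// eq_sym.
by have [->|->] := gs_vec_norm_or_eq0 j; rewrite (mul1r, mulr0).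
Qed.

Lemma gs_reproduces_cong m f g :
  (forall z, p z != 0 -> f z = g z) -> gs_reproduces m f -> gs_reproduces m g.
Proof.
move=> fg rf z pz; rewrite -fg// (rf _ pz).
by apply: eq_bigr => i _; congr (_ * _); apply: dotp_congl.
Qed.

(** On the support, [e j] is its projection on the earlier vectors plus the residual, and the
    residual is a multiple of [gs_vec j]. *)
Lemma gs_reproduces_family m j : (j < m)%N -> gs_reproduces m (e j).
Proof.
move=> jm.
pose N := Num.sqrt (dotp p (gs_residual j) (gs_residual j)).
pose c i := if i == j then N else dotp p (e j) (gs_vec i).
apply: (@gs_reproduces_cong _
    (fun z => \sum_(i <- index_iota 0 j.+1) c i * gs_vec i z)); last first.
  apply: gs_reproduces_sum => i; rewrite mem_index_iota => /= ij.
  by apply: gs_reproduces_vec; apply: leq_trans jm.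
move=> z pz; rewrite big_nat_recr//= {2}/c eqxx.
have -> : N * gs_vec j z = gs_residual j z.
  (* If [N = 0], the residual has zero squared norm and hence vanishes on the support, where [z]
     lies. *)
  rewrite gs_vecE -/N; have [N0|N0] := eqVneq N 0; last by rewrite mulVKf.
  rewrite N0 mul0r (@dotp_eq0 (gs_residual j))//.
  by apply/eqP; rewrite eq_le dotp_ge0 andbT -sqrtr_eq0 -/N N0.
rewrite /gs_residual addrC.
rewrite [X in _ - X](_ : _ = \sum_(0 <= i < j) c i * gs_vec i z).
  by rewrite subrK.
by apply: eq_big_nat => i /andP[_ ij]; rewrite /c ltn_eqF.
Qed.
End GramSchmidt.

(** * Integration over the unit square of functions of two quantiles *)

Lemma integrable_indic_ltey (d : measure_display) (T : measurableType d)
    (R : realType) (mu : {measure set T -> \bar R}) (D A : set T) :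
  measurable D -> measurable A -> (mu (A `&` D) < +oo)%E ->
  mu.-integrable D (fun w => (\1_A w)%:E).
Proof.
move=> mD mA muA; apply/integrableP; split.
  apply/measurable_realfun.measurable_EFinP.
  exact: measurable_realfun.measurable_indic.
under eq_integral do rewrite abse_EFin ger0_norm//.
by rewrite integral_indic.
Qed.

Section SquareIntegral.
Variables (R : realType) (n : nat) (p q : 'I_n.+1 -> R).
Hypotheses (p_ge0 : forall z, 0 <= p z) (p_sum1 : \sum_z p z = 1).
Hypotheses (q_ge0 : forall z, 0 <= q z) (q_sum1 : \sum_z q z = 1).

Let cell (c : 'I_n.+1 * 'I_n.+1) : set (R * R) :=
  [set` quantile_cell p c.1] `*` [set` quantile_cell q c.2].

Let mu := (@lebesgue_measure R \x @lebesgue_measure R)%E.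

Let measurable_cell c : measurable (cell c).
Proof. by apply: measurableX; exact: measurable_itv. Qed.

Lemma measurable_unit_square : measurable (@unit_square R).
Proof. by apply: measurableX; exact: measurable_itv. Qed.

Let mu_cell c : mu (cell c `&` @unit_square R) = (p c.1 * q c.2)%:E.
Proof.
rewrite setIidl; last first.
  move=> w [w1 w2]; split.
    exact: (quantile_cell_sub01 p_ge0 p_sum1 w1).
  exact: (quantile_cell_sub01 q_ge0 q_sum1 w2).
rewrite /mu product_measure1E; [|exact: measurable_itv..].
by rewrite EFinM; congr (_ * _)%E; exact: lebesgue_quantile_cell.
Qed.

(** The product cells partition the square, so such a function is a step function; measurability and
    the integral reduce to finite sums. *)
Lemma quantile_square_simple (f : 'I_n.+1 -> 'I_n.+1 -> R) (w : R * R) :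
  w \in @unit_square R ->
  f (quantile p w.1) (quantile q w.2) = \sum_c f c.1 c.2 * \1_(cell c) w.
Proof.
rewrite inE => -[/=]; rewrite !in_itv /= => w1 w2.
rewrite (bigD1 (quantile p w.1, quantile q w.2))//= big1 ?addr0.
  rewrite indicE mem_set ?mulr1//; split; rewrite /=.
    by rewrite quantile_cellP.
  by rewrite quantile_cellP.
move=> -[x y] xy; rewrite indicE memNset ?mulr0// => -[/=].
by rewrite !quantile_cellP// => /eqP Qx /eqP Qy; rewrite Qx Qy eqxx in xy.
Qed.

Lemma measurable_quantile_square (f : 'I_n.+1 -> 'I_n.+1 -> R) :
  measurable_fun (@unit_square R)
    (fun w : R * R => f (quantile p w.1) (quantile q w.2)).
Proof.
apply: (eq_measurable_fun (fun w => \sum_c f c.1 c.2 * \1_(cell c) w)).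
  by move=> w wD; rewrite (quantile_square_simple _ wD).
apply: measurable_sum => c; apply: measurable_realfun.measurable_funM; first exact: measurable_cst.
exact: measurable_realfun.measurable_indic.
Qed.

Lemma square_integral_quantile (f : 'I_n.+1 -> 'I_n.+1 -> R) :
  square_integral (fun u v => f (quantile p u) (quantile q v)) =
  (\sum_x \sum_y f x y * (p x * q y))%:E.
Proof.
(* [f] may change sign, so linearity of the integral needs integrability of each cell indicator. *)
have int_cell c : mu.-integrable (@unit_square R) (fun w => (\1_(cell c) w)%:E).
  apply: integrable_indic_ltey; [exact: measurable_unit_square|
    exact: measurable_cell|].
  by have := ltry (p c.1 * q c.2); rewrite -mu_cell.
rewrite /square_integral.
transitivity (\int[mu]_(w in @unit_square R)
    \sum_(c : 'I_n.+1 * 'I_n.+1) (f c.1 c.2)%:E * (\1_(cell c) w)%:E)%E.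
  apply: eq_integral => w wD; rewrite quantile_square_simple// -sumEFin.
  by apply: eq_bigr => c _; rewrite EFinM.
rewrite integral_sum; [|exact: measurable_unit_square|]; last first.
  by move=> c; apply: integrableZl; first exact: measurable_unit_square.
rewrite pair_bigA -sumEFin; apply: eq_bigr => c _.
rewrite integralZl; [|exact: measurable_unit_square|exact: int_cell].
rewrite EFinM; congr (_ * _)%E; rewrite -mu_cell.
by apply: integral_indic; [exact: measurable_unit_square|exact: measurable_cell].
Qed.
End SquareIntegral.

(** * Separation by the score and completeness of the LP basis *)

Section LPBasisTheory.
Variables (R : realType) (n : nat) (p : 'I_n.+1 -> R).
Hypotheses (p_ge0 : forall z, 0 <= p z) (p_sum1 : \sum_z p z = 1).

Lemma pmf_le1 z : p z <= 1.
Proof. by rewrite -p_sum1 (bigD1 z)//= lerDl sumr_ge0. Qed.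

(** The increment of the mid-distribution from [z] to [w] is at least [(p z + p w) / 2], so mass at
    either end suffices. *)
Lemma mid_dist_fun_lt (z w : 'I_n.+1) :
  (z < w)%N -> 0 < p z + p w -> mid_dist_fun p z < mid_dist_fun p w.
Proof.
move=> zw pzw; have := dist_fun_le_sub p_ge0 zw; rewrite /mid_dist_fun; lra.
Qed.

Lemma mid_dist_fun_neq z w :
  p z != 0 -> w != z -> mid_dist_fun p w != mid_dist_fun p z.
Proof.
move=> pz wz; have lt_pz : 0 < p z by rewrite lt_def pz p_ge0.
have := p_ge0 w; case: (ltngtP w z) => [lt_wz|lt_zw|/val_inj wE] pw.
- by rewrite lt_eqF// mid_dist_fun_lt// ltr_wpDl.
- by rewrite gt_eqF// mid_dist_fun_lt// ltr_pwDl.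
- by rewrite wE eqxx in wz.
Qed.

(** Exhibits the variance factor under the root in [lp_T1] as a sum of nonnegative terms. *)
Lemma sum_cube_pmf : 1 - \sum_z p z ^+ 3 = \sum_z p z * (1 - p z ^+ 2).
Proof.
rewrite -{1}p_sum1 -sumrB; apply: eq_bigr => z _.
by rewrite mulrBr mulr1 exprS.
Qed.

Lemma pmf_sub_cube_ge0 z : 0 <= p z * (1 - p z ^+ 2).
Proof. by rewrite mulr_ge0// subr_ge0 expr_le1// pmf_le1. Qed.

(** Each nonnegative term [p w * (1 - p w ^+ 2)] must vanish; at [z] this forces [p z = 1], leaving
    no mass elsewhere. *)
Lemma point_mass_of_sum_cube z : p z != 0 -> 1 - \sum_w p w ^+ 3 = 0 ->
  forall w, p w != 0 -> w = z.
Proof.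
move=> pz; rewrite sum_cube_pmf => /eqP.
rewrite psumr_eq0 => [/allP/(_ z (mem_index_enum _))|w _]; last first.
  exact: pmf_sub_cube_ge0.
rewrite /= mulf_eq0 (negbTE pz)/= subr_eq0 eq_sym sqrf_eq1 => /orP[|/eqP]; last first.
  by move=> pzN; have := p_ge0 z; rewrite pzN; lra.
move=> /eqP pz1 w pw; apply/eqP/negPn/negP => wz.
have := p_sum1; rewrite (bigD1 z)//= (bigD1 w)//= pz1.
have : 0 < p w by rewrite lt_def pw p_ge0.
have : 0 <= \sum_(i < n.+1 | (i != z) && (i != w)) p i by apply: sumr_ge0.
by move=> *; lra.
Qed.

Lemma lp_T1_neq z w : 1 - \sum_w p w ^+ 3 != 0 ->
  p z != 0 -> w != z -> lp_T1 p w != lp_T1 p z.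
Proof.
move=> c0 pz wz; rewrite /lp_T1.
have cgt : 0 < 1 - \sum_w p w ^+ 3.
  rewrite lt_def c0 sum_cube_pmf; apply: sumr_ge0 => i _.
  exact: pmf_sub_cube_ge0.
rewrite -subr_eq0 -mulrBl -mulrBr mulf_neq0//; last first.
  by rewrite invr_neq0// sqrtr_eq0 -ltNge.
rewrite mulf_neq0 ?sqrtr_eq0 -?ltNge ?ltr0n//.
by rewrite opprB addrA subrK subr_eq0 mid_dist_fun_neq.
Qed.

Lemma lp_T_reproduces_horner (P : {poly R}) : (size P <= n.+1)%N ->
  gs_reproduces p (lp_power p) n.+1 (fun z => P.[lp_T1 p z]).
Proof.
move=> sP; apply: (@gs_reproduces_cong _ _ _ _ _
    (fun z => \sum_(i <- index_iota 0 n.+1) P`_i * lp_power p i z)).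
  move=> z _; rewrite (horner_coef_wide _ sP).
  by rewrite big_mkord.
apply: gs_reproduces_sum => i; rewrite mem_index_iota => /= ij.
exact: gs_reproduces_family.
Qed.

Lemma lp_T_reproduces_delta z0 : p z0 != 0 ->
  gs_reproduces p (lp_power p) n.+1 (fun z => (z == z0)%:R).
Proof.
move=> pz0; have [c0|c0] := eqVneq (1 - \sum_w p w ^+ 3) 0.
  (* p is the point mass at z0, so the indicator is p-a.e. the power 0 of T_1;
     otherwise it is a Lagrange polynomial in T_1. *)
  apply: (gs_reproduces_cong _
    (gs_reproduces_family p_ge0 (lp_power p) (ltn0Sn n))).
  by move=> z pz; rewrite /lp_power expr0 (point_mass_of_sum_cube pz0 c0 pz) eqxx.
pose L := \prod_(w < n.+1 | w != z0) ('X - (lp_T1 p w)%:P).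
(* The product runs over null vertices too, so separation of [z0] from every other vertex is used;
   with [n] factors, [L] meets the size bound [n.+1]. *)
have L0 : L.[lp_T1 p z0] != 0.
  rewrite horner_prod; apply/prodf_neq0 => w wz0.
  by rewrite hornerXsubC subr_eq0 eq_sym lp_T1_neq.
apply: (@gs_reproduces_cong _ _ _ _ _
    (fun z => ((L.[lp_T1 p z0])^-1 *: L).[lp_T1 p z])); last first.
  apply: lp_T_reproduces_horner; rewrite (leq_trans (size_scale_leq _ _))//.
  rewrite /L -big_filter size_prod_XsubC ltnS.
  rewrite size_filter -sum1_count sum1_card.
  by rewrite cardC1 card_ord.
move=> z pz; rewrite hornerZ; have [->|zz0] := eqVneq z z0.
  by rewrite mulVf.
suff -> : L.[lp_T1 p z] = 0 by rewrite mulr0.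
by rewrite horner_prod (bigD1 z)//= hornerXsubC subrr mul0r.
Qed.

Lemma lp_TE j : lp_T p j = gs_vec p (lp_power p) j.
Proof. by []. Qed.

(** This is the expansion of the indicator of [z0], whose [j]-th Fourier coefficient is
    [lp_T p j z0 * p z0], divided by [p z0]. *)
Lemma lp_T_completeness z z0 : p z != 0 -> p z0 != 0 ->
  \sum_(0 <= j < n.+1) lp_T p j z * lp_T p j z0 = (z == z0)%:R / p z0.
Proof.
move=> pz pz0; apply: (canRL (mulfK pz0)).
rewrite (lp_T_reproduces_delta pz0 pz) mulr_suml; apply: eq_bigr => j _.
rewrite -lp_TE /dotp (bigD1 z0)//= eqxx mul1r big1 ?addr0; last first.
  by move=> w /negbTE ->; rewrite !mul0r.
by rewrite mulrC mulrA mulrAC [RHS]mulrC; ring.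
Qed.

Lemma lp_T0 z : lp_T p 0 z = 1.
Proof.
rewrite /lp_T /gs_step /=.
under [X in dotp p X _]eq_fun do rewrite big_nil subr0 /lp_power expr0.
under [X in dotp p _ X]eq_fun do rewrite big_nil subr0 /lp_power expr0.
rewrite big_nil subr0 /lp_power expr0.
have -> : dotp p (fun=> 1) (fun=> 1) = 1.
  by rewrite -[RHS]p_sum1; apply: eq_bigr => i _; rewrite !mul1r.
by rewrite sqrtr1 divr1.
Qed.

Lemma lp_T_orth i j : i != j -> dotp p (lp_T p i) (lp_T p j) = 0.
Proof. exact: gs_vec_orth. Qed.

Lemma lp_T_mean0 j : (0 < j)%N -> \sum_z lp_T p j z * p z = 0.
Proof.
move=> j0; rewrite -[RHS](lp_T_orth (lt0n_neq0 j0)).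
by apply: eq_bigr => z _; rewrite lp_T0 mulr1.
Qed.

(* By completeness the diagonal of the reproducing kernel sums to the number of
   vertices, while each of the n.+1 squared norms is at most 1. *)
Lemma lp_T_norm1 : (forall z, p z != 0) ->
  forall j, (j < n.+1)%N -> dotp p (lp_T p j) (lp_T p j) = 1.
Proof.
move=> p0 j jn.
have le1 i : dotp p (lp_T p i) (lp_T p i) <= 1.
  have [H|H] := gs_vec_norm_or_eq0 p_ge0 (lp_power p) i; first by rewrite lp_TE H.
  by rewrite lp_TE /dotp big1 ?ler01// => z _; rewrite H !mul0r.
have : \sum_(0 <= i < n.+1) (1 - dotp p (lp_T p i) (lp_T p i)) = 0.
  (* There are as many indices as vertices, so the ones are redistributed over the vertices, and
     each [z] contributes 1 minus [p z] times the kernel at [(z, z)]. *)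
  rewrite sumrB /dotp exchange_big/= big_mkord -sumrB big1// => z _.
  by rewrite -mulr_suml lp_T_completeness// eqxx mul1r mulVf// subrr.
move=> /eqP; rewrite big_mkord psumr_eq0 => [/allP|i _]; last by rewrite subr_ge0.
move=> /(_ (Ordinal jn) (mem_index_enum _)) /=.
by rewrite subr_eq0 => /eqP <-.
Qed.
End LPBasisTheory.

(** * The graph density and its LP coefficients *)

Section GraphPmf.
Variables (R : realType) (n : nat) (A : 'M[R]_n.+1).
Hypothesis A_ge0 : forall x y : 'I_n.+1, 0 <= A x y.
Hypothesis N_gt0 : 0 < total_weight A.

Lemma joint_pmf_ge0 x y : 0 <= joint_pmf A x y.
Proof. by rewrite divr_ge0// ltW. Qed.

Lemma pmfXE x : pmfX A x = \sum_y joint_pmf A x y.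
Proof. by rewrite /pmfX mulr_suml. Qed.

Lemma pmfYE y : pmfY A y = \sum_x joint_pmf A x y.
Proof. by rewrite /pmfY mulr_suml. Qed.

Lemma joint_pmf_sum1 : \sum_x \sum_y joint_pmf A x y = 1.
Proof.
rewrite -(divff (lt0r_neq0 N_gt0)) /total_weight [RHS]mulr_suml.
by apply: eq_bigr => x _; rewrite mulr_suml.
Qed.

Lemma pmfX_ge0 x : 0 <= pmfX A x.
Proof. by rewrite pmfXE sumr_ge0// => y _; exact: joint_pmf_ge0. Qed.

Lemma pmfY_ge0 y : 0 <= pmfY A y.
Proof. by rewrite pmfYE sumr_ge0// => x _; exact: joint_pmf_ge0. Qed.

Lemma pmfX_sum1 : \sum_x pmfX A x = 1.
Proof. by rewrite -joint_pmf_sum1; apply: eq_bigr => x _; exact: pmfXE. Qed.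

Lemma pmfY_sum1 : \sum_y pmfY A y = 1.
Proof.
by rewrite -joint_pmf_sum1 exchange_big; apply: eq_bigr => y _; exact: pmfYE.
Qed.

(** A null marginal is a vanishing sum of nonnegative masses; this makes division by a zero marginal
    harmless. *)
Lemma joint_pmf_eq0l x y : pmfX A x = 0 -> joint_pmf A x y = 0.
Proof.
move=> /eqP; rewrite pmfXE psumr_eq0 => [/allP/(_ y (mem_index_enum _))/eqP//|z _].
exact: joint_pmf_ge0.
Qed.

Lemma joint_pmf_eq0r x y : pmfY A y = 0 -> joint_pmf A x y = 0.
Proof.
move=> /eqP; rewrite pmfYE psumr_eq0 => [/allP/(_ x (mem_index_enum _))/eqP//|z _].
exact: joint_pmf_ge0.
Qed.

Lemma square_density_graph_density : square_density (graph_density A).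
Proof.
pose c x y := joint_pmf A x y / (pmfX A x * pmfY A y).
split.
- exact: (measurable_quantile_square pmfX_ge0 pmfX_sum1 pmfY_ge0 pmfY_sum1 c).
- move=> u v _ _; rewrite divr_ge0 ?joint_pmf_ge0// mulr_ge0 ?pmfX_ge0//.
  exact: pmfY_ge0.
- rewrite (square_integral_quantile pmfX_ge0 pmfX_sum1 pmfY_ge0 pmfY_sum1 c).
  rewrite -joint_pmf_sum1; congr EFin.
  apply: eq_bigr => x _; apply: eq_bigr => y _; rewrite /c.
  (* Where a marginal is zero the quotient cannot be cancelled, but both sides are zero. *)
  have [px0|px0] := eqVneq (pmfX A x) 0.
    by rewrite joint_pmf_eq0l// !mul0r.
  have [py0|py0] := eqVneq (pmfY A y) 0.
    by rewrite joint_pmf_eq0r// !mul0r.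
  by rewrite divfK// mulf_neq0.
Qed.

(** Inner products of product basis functions factor, so orthonormality on the square reduces to
    each coordinate. *)
Lemma square_integral_lp_S j k j' k' :
  square_integral (fun u v : R =>
    (lp_S (pmfX A) j u * lp_S (pmfY A) k v)
      * (lp_S (pmfX A) j' u * lp_S (pmfY A) k' v)) =
  (dotp (pmfX A) (lp_T (pmfX A) j) (lp_T (pmfX A) j') *
   dotp (pmfY A) (lp_T (pmfY A) k) (lp_T (pmfY A) k'))%:E.
Proof.
rewrite (square_integral_quantile pmfX_ge0 pmfX_sum1 pmfY_ge0 pmfY_sum1
  (fun x y => lp_T (pmfX A) j x * lp_T (pmfY A) k y
              * (lp_T (pmfX A) j' x * lp_T (pmfY A) k' y))).
congr EFin; rewrite mulr_suml; apply: eq_bigr => x _.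
by rewrite mulr_sumr; apply: eq_bigr => y _; ring.
Qed.

Lemma lp_coef00 : lp_coef A 0 0 = 1.
Proof.
rewrite -joint_pmf_sum1; apply: eq_bigr => x _; apply: eq_bigr => y _.
by rewrite lp_T0 ?pmfX_sum1// lp_T0 ?pmfY_sum1// !mulr1.
Qed.

(** Since the function of index 0 is constant, summing out [y] leaves the mean of a centered
    function. *)
Lemma lp_coefj0 j : (0 < j)%N -> lp_coef A j 0 = 0.
Proof.
move=> j0; rewrite -(lp_T_mean0 pmfX_ge0 pmfX_sum1 j0).
apply: eq_bigr => x _; rewrite pmfXE mulr_sumr; apply: eq_bigr => y _.
by rewrite lp_T0 ?pmfY_sum1// mulr1 mulrC.
Qed.

Lemma lp_coef0k k : (0 < k)%N -> lp_coef A 0 k = 0.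
Proof.
move=> k0; rewrite -(lp_T_mean0 pmfY_ge0 pmfY_sum1 k0) /lp_coef exchange_big.
apply: eq_bigr => y _; rewrite pmfYE mulr_sumr; apply: eq_bigr => x _.
by rewrite lp_T0 ?pmfX_sum1// mulr1 mulrC.
Qed.

Lemma lp_coef_expansion x0 y0 : pmfX A x0 != 0 -> pmfY A y0 != 0 ->
  \sum_(0 <= j < n.+1) \sum_(0 <= k < n.+1)
     lp_coef A j k * lp_T (pmfX A) j x0 * lp_T (pmfY A) k y0 =
  joint_pmf A x0 y0 / (pmfX A x0 * pmfY A y0).
Proof.
move=> px0 py0.
(* Unfolding the coefficients and exchanging sums separates the [j] and [k] sums into one
   reproducing kernel per coordinate. *)
transitivity (\sum_x \sum_y joint_pmf A x y *
   ((\sum_(0 <= j < n.+1) lp_T (pmfX A) j x * lp_T (pmfX A) j x0) *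
    (\sum_(0 <= k < n.+1) lp_T (pmfY A) k y * lp_T (pmfY A) k y0))).
  under [RHS]eq_bigr do under eq_bigr do rewrite mulr_suml mulr_sumr.
  under [RHS]eq_bigr do rewrite exchange_big.
  rewrite [RHS]exchange_big; apply: eq_bigr => j _.
  under [RHS]eq_bigr do under eq_bigr do rewrite !mulr_sumr.
  under [RHS]eq_bigr do rewrite exchange_big.
  rewrite [RHS]exchange_big; apply: eq_bigr => k _.
  rewrite /lp_coef !mulr_suml; apply: eq_bigr => x _.
  by rewrite !mulr_suml; apply: eq_bigr => y _; ring.
transitivity (\sum_x \sum_y joint_pmf A x y *
    (((x == x0)%:R / pmfX A x0) * ((y == y0)%:R / pmfY A y0))).
  apply: eq_bigr => x _; apply: eq_bigr => y _.
  (* Completeness holds only on the supports; elsewhere the joint mass is zero. *)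
  have [px|px] := eqVneq (pmfX A x) 0; first by rewrite joint_pmf_eq0l// !mul0r.
  have [py|py] := eqVneq (pmfY A y) 0; first by rewrite joint_pmf_eq0r// !mul0r.
  rewrite (lp_T_completeness pmfX_ge0 pmfX_sum1)//.
  by rewrite (lp_T_completeness pmfY_ge0 pmfY_sum1).
rewrite (bigD1 x0)//= [X in _ + X]big1 ?addr0 => [|x /negbTE ->]; last first.
  by apply: big1 => y _; rewrite !mul0r mulr0.
rewrite (bigD1 y0)//= big1 ?addr0 => [|y /negbTE ->]; last first.
  by rewrite !mul0r !mulr0.
by rewrite !eqxx !mul1r -invfM.
Qed.
End GraphPmf.

(** * Density property, orthonormality and decomposition combined *)

Unset Implicit Arguments.

Theorem theorem2p2 (R : realType) (n : nat) (A : 'M[R]_n.+1)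
    (A_ge0 : forall x y : 'I_n.+1, 0 <= A x y)
    (N_gt0 : 0 < total_weight A) :
  [/\ square_density (graph_density A),
      (forall j k j' k' : nat,
         (1 <= j < n.+1)%N -> (1 <= k < n.+1)%N ->
         (1 <= j' < n.+1)%N -> (1 <= k' < n.+1)%N ->
         (j, k) <> (j', k') ->
         square_integral (fun u v : R =>
           (lp_S (pmfX A) j u * lp_S (pmfY A) k v)
             * (lp_S (pmfX A) j' u * lp_S (pmfY A) k' v)) = 0%E),
      ((forall x : 'I_n.+1, 0 < pmfX A x) ->
       (forall y : 'I_n.+1, 0 < pmfY A y) ->
       forall j k : nat, (1 <= j < n.+1)%N -> (1 <= k < n.+1)%N ->
         square_integral (fun u v : R =>
           (lp_S (pmfX A) j u * lp_S (pmfY A) k v) ^+ 2) = 1%E)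
    & forall (x y : 'I_n.+1) (u v : R),
        u = dist_fun (pmfX A) x -> v = dist_fun (pmfY A) y ->
        pmfX A (quantile (pmfX A) u) != 0 ->
        pmfY A (quantile (pmfY A) v) != 0 ->
        graph_density A u v - 1 =
          \sum_(1 <= j < n.+1) \sum_(1 <= k < n.+1)
            lp_coef A j k * lp_S (pmfX A) j u * lp_S (pmfY A) k v].
Proof.
have pX := pmfX_ge0 A_ge0 N_gt0; have pY := pmfY_ge0 A_ge0 N_gt0.
split.
- exact: square_density_graph_density.
- move=> j k j' k' _ _ _ _ jkN; rewrite square_integral_lp_S//.
  (* Distinct index pairs differ in some coordinate, and the factor of that coordinate vanishes. *)
  have [jj'|jj'] := eqVneq j j'; last by rewrite (lp_T_orth pX jj') mul0r.
  have [kk'|kk'] := eqVneq k k'; last by rewrite (lp_T_orth pY kk') mulr0.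
  by rewrite jj' kk' in jkN.
- move=> pX_gt0 pY_gt0 j k /andP[_ jn] /andP[_ kn].
  rewrite (_ : square_integral _ = square_integral (fun u v : R =>
    (lp_S (pmfX A) j u * lp_S (pmfY A) k v)
      * (lp_S (pmfX A) j u * lp_S (pmfY A) k v))); last first.
    by congr square_integral; apply/funext => u; apply/funext => v; rewrite expr2.
  rewrite square_integral_lp_S//.
  (* Positive marginals exclude null vectors, so both factors are exactly 1. *)
  rewrite (lp_T_norm1 pX (pmfX_sum1 N_gt0)) => [|x|//]; last exact: lt0r_neq0.
  rewrite (lp_T_norm1 pY (pmfY_sum1 N_gt0)) ?mulr1// => y; exact: lt0r_neq0.
- move=> _ _ u v _ _ pu pv.
  rewrite /graph_density -(lp_coef_expansion A_ge0 N_gt0 pu pv).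
  have tail0 (F : nat -> R) : (forall i, (0 < i)%N -> F i = 0) ->
      \sum_(1 <= i < n.+1) F i = 0.
    by move=> F0; apply: big1_seq => i; rewrite mem_index_iota => /andP[_ /andP[/F0]].
  (* The full expansion starts at index 0: the row [j = 0] sums to [lp_coef A 0 0 = 1], and in the
     other rows the term [k = 0] vanishes. *)
  apply/eqP; rewrite subr_eq addrC; apply/eqP; rewrite big_ltn//; congr (_ + _).
    rewrite big_ltn// lp_coef00// !lp_T0 ?pmfX_sum1 ?pmfY_sum1// !mulr1.
    by rewrite tail0 ?addr0// => k k0; rewrite lp_coef0k// !mul0r.
  apply: eq_big_nat => j /andP[j0 _].
  by rewrite big_ltn// lp_coefj0// !mul0r add0r.
Qed.
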